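(* Let $k,r\ge 1$ be integers, $p\in(0,1)$, $q=1-p$. Let $Y$ be the waiting time for the $r$-th nonoverlapping success run of length $k$ (negative binomial distribution $\mathrm{NB}_{k,r}$ of Type I). Then: (i) for every integer $n\ge 1$, $$\mathbb{P}(Y-rk=n)=p^{rk}\Biggl[qr\,{}_2F_1(1-n,1-r,2;q)+\sum_{j=1}^{\lfloor (n-1)/k\rfloor}(-1)^jp^{jk}q^j\binom{r+j-1}{r-1}\binom{n-jk-1}{j-1}\,{}_2F_1(jk+j-n,-r,j;q)\Biggr];$$ (ii) for every integer $n\ge rk+1$, $$\mathbb{P}(Y=n)=p^{rk}\Biggl[qr\,{}_2F_1(rk+1-n,1-r,2;q)+\sum_{j=1}^{\lfloor (n-rk-1)/k\rfloor}(-1)^jp^{jk}q^j\binom{n-(r+j)k-1}{j-1}\binom{r+j-1}{r-1}\,{}_2F_1((r+j)k+j-n,-r,j;q)\Biggr].$$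
   Context: Consider independent Bernoulli trials, indexed $1,2,3,\dots$, each with success probability $p$. Success runs of length $k$ are counted in the nonoverlapping sense: as soon as $k$ consecutive successes are attained, a run is counted and the counting for a new run begins from scratch with the next trial. $Y$ is the index of the trial at which the $r$-th such run is completed; equivalently, $Y$ is the sum of $r$ independent copies of the waiting time for the first run of $k$ consecutive successes. Here ${}_2F_1(a,b,c;x)=\sum_{m\ge 0}\frac{a^{\overline m}\,b^{\overline m}}{c^{\overline m}\,m!}x^m$ is the Gauss hypergeometric function, with $a^{\overline m}=a(a+1)\cdots(a+m-1)$ the rising factorial; all series above terminate. Convention: $\binom{a}{b}=0$ unless $0\le b\le a$. *)

(* Defs.v *)
From HB Require Import structures.
From mathcomp Require Import all_boot all_order all_algebra.
From mathcomp Require Import all_classical all_reals all_analysis.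

Set Implicit Arguments.
Unset Strict Implicit.
Unset Printing Implicit Defensive.

Import Order.TTheory GRing.Theory Num.Theory.
Import numFieldNormedType.Exports.

Local Open Scope classical_set_scope.
Local Open Scope ring_scope.

(** * Gauss hypergeometric function *)

Definition rising {R : realType} (a : R) (m : nat) : R :=
  \prod_(i < m) (a + i%:R).

(* [limn] and [_ / 0] are total: the value is meaningful only when the series
   converges (e.g. terminates) and [c] is not a nonpositive integer. *)
Definition hyp2F1 {R : realType} (a b c x : R) : R :=
  limn (series (fun m : nat =>
    rising a m * rising b m / (rising c m * m`!%:R) * x ^+ m)).

(** * Mutual independence of a family of random variables *)

Definition mutually_independent {d d'} {T : measurableType d}
    {T' : measurableType d'} {R : realType} {P : probability T R}
    {I : choiceType} (X : I -> {RV P >-> T'}) : Prop :=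
  forall (s : seq I) (B : I -> set T'), uniq s ->
    (forall i, measurable (B i)) ->
    P (\bigcap_(i in [set` s]) (X i @^-1` B i)) =
    \big[*%E/1%E]_(i <- s) P (X i @^-1` B i).

(** * Nonoverlapping success runs *)

(* Trial number [i.+1] has outcome [x i], with [true] meaning success.  The
   pair consists of the number of runs of length [k] completed so far, and the
   length of the run in progress, which restarts from 0 whenever a run is
   counted. *)
Definition run_step (k : nat) (s : nat * nat) (success : bool) : nat * nat :=
  if success then
    if s.2.+1 == k then (s.1.+1, 0%N) else (s.1, s.2.+1)
  else (s.1, 0%N).

Fixpoint run_state (k : nat) (x : nat -> bool) (n : nat) : nat * nat :=
  if n is m.+1 then run_step k (run_state k x m) (x m) else (0%N, 0%N).

Definition run_count (k : nat) (x : nat -> bool) (n : nat) : nat :=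
  (run_state k x n).1.

(* The least [n] such that trial [n] completes the [r]-th run, and [+oo] if
   fewer than [r] runs are ever completed. *)
Definition waiting_time (R : realType) (k r : nat) (x : nat -> bool) : \bar R :=
  ereal_inf [set (n%:R)%:E | n in [set n | run_count k x n = r]].

(* Main.v *)
Require Import Defs.
From HB Require Import structures.
From mathcomp Require Import all_boot all_order all_algebra qpoly ring zify.
From mathcomp Require Import all_classical all_reals all_analysis.

Import Order.TTheory GRing.Theory Num.Theory.
Import numFieldNormedType.Exports.

Local Open Scope classical_set_scope.
Local Open Scope ring_scope.

(** Follow the number of completed runs and the length of the run in progress.
This pair is a Markov chain, and the event Y = n says that it steps from the
state (r - 1, k - 1) by a success at trial n; hence the law of Y is the
first-passage law [run_time] of the chain ([state_cyl_prob],
[waiting_time_law]).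

Let F_a, T_a and Z_a be the generating functions, in x, whose n-th coefficients
are the probabilities that trial n completes the a-th run, that there are
exactly a runs after n trials, and that the state after n trials is (a, 0).  The transitions of the chain give
  (1 - x) T_a = F_a - F_{a+1},
  Z_a = F_a + q x T_a,
  F_{a+1} = (p x)^k Z_a,
and eliminating Z and T leads to
  F_r = (p x)^{rk} ((1 - p x) / (1 - x + q p^k x^{k+1}))^r.
Since 1 - p x = (1 - x) (1 + q x E) and
1 - x + q p^k x^{k+1} = (1 - x) (1 + q p^k x^{k+1} E) with E = 1 / (1 - x), the
fraction is (1 + q x E)^r (1 + q p^k x^{k+1} E)^{-r}.  Expanding the first
factor by the binomial theorem, and the second one and the powers of E by the
negative binomial series ([nilpotent_negbinom]) gives the coefficients as a
double sum over i and j ([run_gf_expansion], [run_timeE]).  For a fixed j, the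
sum over i is a terminating Gauss series ([scaled_hyp2F1] for j = 0,
[bin_mul_hyp2F1] for j > 0), which is the announced formula
([run_time_hypE]).

A coefficient of a formal power series only depends on the series modulo a
power of x, so the computation takes place in the quotient of the polynomial
ring by a power of the variable, where x is nilpotent and 1 - x is
invertible. *)

(** * The generating function equations in a ring with nilpotent variable *)

(** The negative binomial series of (1 - u)^{-r} is a finite sum when u is
nilpotent.  The truncated subtraction in the binomial coefficient makes it 1
at r = j = 0 and 0 at r = 0 < j, as it should be. *)
Lemma nilpotent_negbinom (A : comNzRingType) (u : A) (M r : nat) :
  (0 < M)%N -> u ^+ M = 0 ->
  (1 - u) ^+ r * \sum_(j < M) u ^+ j *+ 'C(r + j - 1, j) = 1.
Proof.
move=> M_gt0 uM0; elim: r => [|r IHr].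
  rewrite expr0 mul1r -(prednK M_gt0) big_ord_recl bin0 expr0 big1 ?addr0 // => i _.
  by rewrite bin_small ?mulr0n //= /bump leq0n add1n add0n subn1.
rewrite exprSr -mulrA -[RHS]IHr; congr (_ * _).
(* Pascal's rule leaves a single boundary term of order u^(N+1), which vanishes
   at N + 1 = M. *)
have tele N : (1 - u) * \sum_(j < N.+1) u ^+ j *+ 'C(r.+1 + j - 1, j) =
    \sum_(j < N.+1) u ^+ j *+ 'C(r + j - 1, j) - u ^+ N.+1 *+ 'C(r + N, N).
  elim: N => [|N IHN].
    by rewrite !big_ord1 !bin0 !expr0 !mulr1n mulr1 expr1.
  rewrite big_ord_recr mulrDr IHN [in RHS]big_ord_recr /= -addrA -[RHS]addrA.
  congr (_ + _).
  rewrite addSn !subn1 /= addnS /= binS -![u ^+ _ *+ _]mulr_natr natrD [u ^+ N.+2]exprS.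
  by move: (u ^+ N.+1) ('C(_, _)%:R : A) ('C(_, _)%:R : A) => v a b; ring.
by rewrite -(prednK M_gt0) tele prednK // uM0 mul0rn subr0.
Qed.

Section NilpotentRunEquations.
Variables (A : comNzRingType) (x p q : A) (k M : nat) (F T Z : nat -> A).
Hypotheses (M_gt0 : (0 < M)%N) (xM : x ^+ M = 0) (pq : p + q = 1).
(* The unknowns F_a, T_a, Z_a are linked as the generating functions of the run
   chain are. *)
Hypotheses (F0 : F 0 = 1) (TE : forall a, (1 - x) * T a = F a - F a.+1)
  (ZE : forall a, Z a = F a + q * x * T a)
  (FE : forall a, F a.+1 = (p * x) ^+ k * Z a).
Let E := \sum_(i < M) x ^+ i.

Lemma nilpotent_geom : (1 - x) * E = 1.
Proof.
rewrite -[RHS](nilpotent_negbinom _ _ _ 1 M_gt0 xM) expr1; congr (_ * _).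
by apply: eq_bigr => i _; rewrite add1n subn1 /= binn.
Qed.

(** Both sides are inverse to (1 - x)^a. *)
Lemma geom_expE a : E ^+ a = \sum_(l < M) x ^+ l *+ 'C(a + l - 1, l).
Proof.
rewrite -[LHS]mulr1 -(nilpotent_negbinom _ _ _ a M_gt0 xM) mulrA -exprMn.
by rewrite (mulrC E) nilpotent_geom expr1n mul1r.
Qed.

(** Elimination of T and Z. *)
Lemma run_gf_step a :
  F a.+1 * (1 - x + q * x * (p * x) ^+ k) = (p * x) ^+ k * (1 - p * x) * F a.
Proof.
have H : (1 - x) * Z a = (1 - p * x) * F a - q * x * F a.+1.
  have -> : p = 1 - q by rewrite -pq addrK.
  by rewrite ZE mulrDr mulrCA TE; ring.
rewrite mulrDr [F a.+1 * (1 - x)]mulrC [in X in X + _]FE mulrCA H; ring.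
Qed.

(** By [run_gf_step], passing from F_a to F_{a+1} multiplies by (p x)^k and by
the quotient of 1 - p x by 1 - x + q x (p x)^k.  Both have the factor 1 - x,
with cofactors 1 + q x E and 1 - U, where U is nilpotent. *)
Lemma run_gfE r : F r = (p * x) ^+ (r * k) * (1 + q * x * E) ^+ r *
  \sum_(j < M) (- (q * x * (p * x) ^+ k * E)) ^+ j *+ 'C(r + j - 1, j).
Proof.
set U := - _; set S := \sum_(j < M) _.
have UM : U ^+ M = 0.
  by rewrite /U -mulrN (mulrC q) -!mulrA exprMn xM mul0r.
have SE : (1 - U) ^+ r * S = 1 by exact: nilpotent_negbinom.
have denE : 1 - x + q * x * (p * x) ^+ k = (1 - x) * (1 - U).
  transitivity (1 - x + q * x * (p * x) ^+ k * ((1 - x) * E)).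
    by rewrite nilpotent_geom mulr1.
  by rewrite /U; ring.
have numE : (1 - p * x) = (1 - x) * (1 + q * x * E).
  transitivity (1 - x + q * x * ((1 - x) * E)); last by ring.
  by rewrite nilpotent_geom mulr1 (_ : q = 1 - p); [ring | rewrite -pq addrC addKr].
have stepE a : F a.+1 * (1 - U) = (p * x) ^+ k * (1 + q * x * E) * F a.
  have geomK : cancel ( *%R (1 - x)) ( *%R E).
    by move=> y; rewrite mulrA (mulrC E) nilpotent_geom mul1r.
  apply: (can_inj geomK).
  by rewrite mulrCA -denE run_gf_step numE; ring.
have powE : F r * (1 - U) ^+ r = (p * x) ^+ (r * k) * (1 + q * x * E) ^+ r.
  elim: r {S SE} => [|a IHa]; first by rewrite F0 !expr0 mulr1.
  by rewrite exprS mulrA stepE -mulrA IHa mulSn exprD exprS; ring.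
by rewrite -powE -mulrA SE mulr1.
Qed.

Lemma run_gf_expansion r : F r = \sum_(j < M) \sum_(i < r.+1) \sum_(l < M)
  ((-1) ^+ j * p ^+ (r * k + j * k) * q ^+ (i + j)
    * x ^+ (r * k + (j * k + j + i) + l))
  *+ ('C(r, i) * 'C(r + j - 1, j) * 'C(i + j + l - 1, l)).
Proof.
rewrite run_gfE mulr_sumr; apply: eq_bigr => j _.
rewrite exprDn mulr_sumr mulr_suml; apply: eq_bigr => i _.
set d := 'C(r, i); set c := 'C(r + j - 1, j).
transitivity (((-1) ^+ j * p ^+ (r * k + j * k) * q ^+ (i + j)
    * x ^+ (r * k + (j * k + j + i)) * E ^+ (i + j)) *+ (d * c)).
  rewrite expr1n mul1r -[- _]mulN1r !exprMn -!exprM !exprD !mulrnAr mulrnAl mulrnA.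
  by rewrite (mulnC k); congr (_ *+ _ *+ _); ring.
rewrite geom_expE mulr_sumr -sumrMnl; apply: eq_bigr => l _.
by rewrite mulrnAr -mulrA -exprD -mulrnA (mulnC _ (d * c)%N).
Qed.

End NilpotentRunEquations.

(** * Truncated generating functions *)

Section Truncation.
Variables (R : comNzRingType) (M : nat).

Definition trunc_gf (a : nat -> R) : {poly %/ ('X^(M.+1) : {poly R})} :=
  in_qpoly ('X^(M.+1)) (\poly_(i < M.+1) a i).

Lemma coef_in_qpolyXn (P : {poly R}) n : (n < M.+1)%N ->
  (in_qpoly ('X^(M.+1)) P : {poly R})`_n = P`_n.
Proof.
move=> nM; rewrite /= mk_monic_Xn /=.
rewrite {2}(Pdiv.RingMonic.rdivp_eq (monicXn R M.+1) P) coefD coefMXn nM add0r.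
by [].
Qed.

Lemma in_qpolyXn_inj (P Q : {poly R}) :
  (forall n, (n < M.+1)%N -> P`_n = Q`_n) ->
  in_qpoly ('X^(M.+1)) P = in_qpoly ('X^(M.+1)) Q.
Proof.
move=> PQ; apply/npolyP => n; have [nM|Mn] := ltnP n M.+1.
  by rewrite !coef_in_qpolyXn // PQ.
by rewrite !big_coef_npoly // mk_monic_Xn size_polyXn.
Qed.

Lemma coef_trunc_gf a n : (n < M.+1)%N -> (trunc_gf a : {poly R})`_n = a n.
Proof. by move=> nM; rewrite coef_in_qpolyXn // coef_poly nM. Qed.

Lemma qX_nilpotent : ('qX : {poly %/ ('X^(M.+1) : {poly R})}) ^+ M.+1 = 0.
Proof.
rewrite /qpolyX -rmorphXn /= -[RHS](in_qpoly0 ('X^(M.+1))).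
by apply: in_qpolyXn_inj => n nM; rewrite coefXn coef0 ltn_eqF.
Qed.

Lemma trunc_gf_shift a :
  trunc_gf a = in_qpoly _ (a 0)%:P + 'qX * trunc_gf (fun n => a n.+1).
Proof.
rewrite /trunc_gf /qpolyX -in_qpolyM -in_qpolyD; apply: in_qpolyXn_inj => n nM.
rewrite coef_poly nM coefD coefC coefXM coef_poly.
by case: n nM => [|n] nM /=; rewrite ?addr0 // (ltnW nM) add0r.
Qed.

Lemma trunc_gfD a b :
  trunc_gf (fun n => a n + b n) = trunc_gf a + trunc_gf b.
Proof.
rewrite /trunc_gf -in_qpolyD; apply: in_qpolyXn_inj => n nM.
by rewrite coefD !coef_poly nM.
Qed.

Lemma trunc_gfM c a :
  trunc_gf (fun n => c * a n) = in_qpoly _ c%:P * trunc_gf a.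
Proof.
rewrite /trunc_gf -in_qpolyM; apply: in_qpolyXn_inj => n nM.
by rewrite coefCM !coef_poly nM.
Qed.

Lemma trunc_gfB a b :
  trunc_gf (fun n => a n - b n) = trunc_gf a - trunc_gf b.
Proof.
rewrite /trunc_gf -rmorphB; apply: in_qpolyXn_inj => n nM.
by rewrite coefB !coef_poly nM.
Qed.

End Truncation.

(** * First passage of the run chain *)

Section RunChain.
Variables (R : comNzRingType) (k : nat) (p : R).
Hypothesis k_gt0 : (0 < k)%N.
Let q := 1 - p.

(** The mean of [f] at the state reached after [m] independent trials of success
probability [p].  The recursion conditions on the last trial, so that the
observable changes and the initial state does not; [state_cyl_prob] follows the
same recursion. *)
Fixpoint run_mean (m : nat) (f : nat * nat -> R) : R :=
  if m is m'.+1 then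
    (1 - p) * run_mean m' (fun s => f (run_step k s false)) +
    p * run_mean m' (fun s => f (run_step k s true))
  else f (0, 0)%N.

Lemma eq_run_mean m f g : f =1 g -> run_mean m f = run_mean m g.
Proof. by move=> /funext ->. Qed.

Lemma run_meanD m f g :
  run_mean m (fun s => f s + g s) = run_mean m f + run_mean m g.
Proof.
elim: m f g => [//|m IHm] f g /=.
by rewrite !IHm !mulrDr addrACA.
Qed.

Lemma run_meanB m f g :
  run_mean m (fun s => f s - g s) = run_mean m f - run_mean m g.
Proof.
elim: m f g => [//|m IHm] f g /=.
by rewrite !IHm !mulrBr opprD addrACA.
Qed.

Lemma run_mean0 m : run_mean m (fun=> 0) = 0.
Proof. by elim: m => [//|m /= ->]; rewrite !mulr0 addr0. Qed.

Definition run_prob m (Q : pred (nat * nat)) := run_mean m (fun s => (Q s)%:R).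

(** The probability that trial [n] completes the [a]-th run; for [a = 0] it is
the unit mass at 0, which is the law of an empty sum of waiting times. *)
Definition run_time (a n : nat) : R :=
  if n is m.+1 then p * run_prob m (fun s => (s.1.+1 == a) && (s.2.+1 == k))
  else (a == 0)%N%:R.

Let T a n := run_prob n (fun s => s.1 == a).
Let U b a n := run_prob n (pred1 (a, b)).

(** The count [a] is left by completing run [a + 1] and entered by completing
run [a]. *)
Lemma run_prob_countS a n :
  T a n.+1 = T a n - run_time a.+1 n.+1 + run_time a n.+1.
Proof.
have succE s : ((run_step k s true).1 == a)%:R = (s.1 == a)%:R -
    ((s.1.+1 == a.+1) && (s.2.+1 == k))%:R
    + ((s.1.+1 == a) && (s.2.+1 == k))%:R :> R.
  rewrite eqSS; case: s => c e; rewrite /run_step /=; case: (eqVneq e.+1 k) => _ /=.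
    by rewrite !andbT subrr add0r.
  by rewrite !andbF subr0 addr0.
rewrite /T /run_prob /= (eq_run_mean _ _ _ succE).
by rewrite run_meanD run_meanB /run_prob; ring.
Qed.

(** An empty run in progress results from a failure or from completing a run. *)
Lemma run_prob_zeroS a n : U 0 a n.+1 = q * T a n + run_time a n.+1.
Proof.
rewrite /U /T /run_prob /=; congr (_ * _ + _ * _); apply: eq_run_mean => -[c e].
  by rewrite /= /run_step /= xpair_eqE eqxx andbT.
rewrite /= /run_step /=; case: (eqVneq e.+1 k) => _ /=; rewrite xpair_eqE /= ?andbT //.
by rewrite (_ : (e.+1 == 0)%N = false) ?andbF.
Qed.

Lemma run_prob_succS b a n : b.+1 != k -> U b.+1 a n.+1 = p * U b a n.
Proof.
move=> bk; rewrite /U /run_prob /=.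
under eq_run_mean => s do rewrite xpair_eqE /= andbF.
rewrite run_mean0 mulr0 add0r; congr (_ * _); apply: eq_run_mean => -[c e].
rewrite /run_step /=; case: (eqVneq e.+1 k) => [ek|_] /=; last by [].
by rewrite !xpair_eqE andbF; move: bk; rewrite -ek eqSS eq_sym => /negPf ->; rewrite andbF.
Qed.

Lemma run_timeSS a n : run_time a.+1 n.+1 = p * U k.-1 a n.
Proof.
rewrite /= /U; congr (_ * _); apply: eq_run_mean => -[c e] /=.
by rewrite eqSS xpair_eqE -[in LHS](prednK k_gt0) eqSS.
Qed.

Section RunGf.
Variable M : nat.
Let gf := @trunc_gf R M.
Let cst (c : R) := in_qpoly ('X^(M.+1)) c%:P.
Let x : {poly %/ ('X^(M.+1) : {poly R})} := 'qX.

Lemma run_time_gf0 : gf (run_time 0) = 1.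
Proof.
rewrite -(in_qpoly1 ('X^(M.+1))); apply: in_qpolyXn_inj => n nM.
rewrite coef_poly nM coefC; case: n nM => [|n] _ //=.
by rewrite /run_prob run_mean0 mulr0.
Qed.

Lemma run_count_gf a :
  (1 - x) * gf (T a) = gf (run_time a) - gf (run_time a.+1).
Proof.
rewrite mulrBl mul1r {1}/gf {1}(trunc_gf_shift _ _ (T a)).
under [X in trunc_gf _ _ X]eq_fun => n do rewrite run_prob_countS.
rewrite trunc_gfD trunc_gfB /gf (trunc_gf_shift _ _ (run_time a)).
rewrite (trunc_gf_shift _ _ (run_time a.+1)) in_qpoly0 add0r.
by rewrite /T /run_prob /= (eq_sym 0%N) -/x; ring.
Qed.

Lemma run_zero_gf a : gf (U 0 a) = gf (run_time a) + cst q * x * gf (T a).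
Proof.
rewrite {1}/gf (trunc_gf_shift _ _ (U 0 a)).
under [X in trunc_gf _ _ X]eq_fun => n do rewrite run_prob_zeroS.
rewrite trunc_gfD trunc_gfM {1}/gf (trunc_gf_shift _ _ (run_time a)).
rewrite /U /run_prob /= xpair_eqE andbT (eq_sym 0%N) -/(cst q) -/x -/gf; ring.
Qed.

Lemma run_progress_gf b a : (b < k)%N ->
  gf (U b a) = (cst p * x) ^+ b * gf (U 0 a).
Proof.
elim: b => [|b IHb] bk; first by rewrite mul1r.
rewrite {1}/gf (trunc_gf_shift _ _ (U b.+1 a)).
under [X in trunc_gf _ _ X]eq_fun => n do rewrite run_prob_succS ?(ltn_eqF bk)//.
rewrite trunc_gfM -/gf IHb 1?ltnW //.
rewrite {1}/U /run_prob /= xpair_eqE andbF in_qpoly0 add0r -/x -/(cst p) (exprS (cst p * x)); ring.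
Qed.

Lemma run_time_gfS a :
  gf (run_time a.+1) = (cst p * x) ^+ k * gf (U 0 a).
Proof.
rewrite {1}/gf (trunc_gf_shift _ _ (run_time a.+1)).
under [X in trunc_gf _ _ X]eq_fun => n do rewrite run_timeSS.
rewrite trunc_gfM -/gf run_progress_gf ?prednK // in_qpoly0 add0r.
rewrite -/x -/(cst p) -[in RHS](prednK k_gt0) (exprS (cst p * x)); ring.
Qed.

End RunGf.

(** Coefficient of x^{rk+n} in [run_gf_expansion].  In the term of indices j, i
the power x^{jk+j+i} has to be completed by x^l from the series of E^{i+j};
only l = n - (jk + j + i) contributes, if it is not negative. *)
Lemma run_timeE r n : run_time r (r * k + n) =
  \sum_(j < (r * k + n).+1) \sum_(i < r.+1)
    if (j * k + j + i <= n)%N then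
      (-1) ^+ j * p ^+ (r * k + j * k) * q ^+ (i + j)
       *+ ('C(r, i) * 'C(r + j - 1, j)
           * 'C(n - j * k - 1, n - (j * k + j + i)))
    else 0.
Proof.
set M := (r * k + n)%N.
have MM : (M < M.+1)%N by [].
rewrite -(coef_trunc_gf _ _ (run_time r) _ MM).
have pq1 : in_qpoly ('X^(M.+1)) p%:P + in_qpoly ('X^(M.+1)) q%:P = 1.
  by rewrite -in_qpolyD -polyCD /q addrC subrK in_qpoly1.
rewrite (run_gf_expansion _ _ _ _ k _ _ _ _ (ltn0Sn M) (qX_nilpotent R M)
  pq1 (run_time_gf0 M) (run_count_gf M) (run_zero_gf M) (run_time_gfS M) r).
pose term (j i l : nat) : {poly R} := ((-1) ^+ j * p ^+ (r * k + j * k)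
    * q ^+ (i + j))%:P * 'X^(r * k + (j * k + j + i) + l) *+
    ('C(r, i) * 'C(r + j - 1, j) * 'C(i + j + l - 1, l)).
rewrite (_ : \sum_(j < M.+1) _ = in_qpoly _
  (\sum_(j < M.+1) \sum_(i < r.+1) \sum_(l < M.+1) term j i l)); last first.
  rewrite rmorph_sum; apply: eq_bigr => j _.
  rewrite rmorph_sum; apply: eq_bigr => i _.
  rewrite rmorph_sum; apply: eq_bigr => l _.
  by rewrite /term rmorphMn !polyCM !rmorphM !polyC_exp !rmorphXn polyCN rmorphN rmorph1.
rewrite coef_in_qpolyXn // coef_sum; apply: eq_bigr => j _.
rewrite coef_sum; apply: eq_bigr => i _; rewrite coef_sum.
under eq_bigr => l _ do rewrite coefMn coefCM coefXn -addnA eqn_add2l.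
case: leqP => dn; last first.
  rewrite big1 // => l _; rewrite ltn_eqF ?mulr0 ?mul0rn //.
  exact: leq_trans dn (leq_addr _ _).
have nM : (n - (j * k + j + i) < M.+1)%N.
  by rewrite ltnS (leq_trans (leq_subr _ _)) ?leq_addl.
rewrite (bigD1 (Ordinal nM)) //= subnKC // eqxx mulr1 big1 ?addr0; last first.
  move=> l /eqP lne; case: eqVneq => [nE|]; last by rewrite mulr0 mul0rn.
  by case: lne; apply: val_inj; rewrite /= nE addKn.
congr (_ *+ (_ * 'C(_, _))).
by rewrite addnC -{1}(subnK dn); congr (_ - 1)%N; lia.
Qed.

End RunChain.

(** * Terminating Gauss series *)

Section Hypergeometric.
Variable R : realType.
Implicit Types (a b c x q : R) (n r j m N : nat).

Lemma risingS a m : rising a m.+1 = rising a m * (a + m%:R).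
Proof. by rewrite /rising big_ord_recr. Qed.

Lemma rising_eq0_le b N m : rising b N = 0 -> (N <= m)%N -> rising b m = 0.
Proof.
move=> bN0; elim: m => [|m IHm]; first by rewrite leqn0 => /eqP <-.
by rewrite leq_eqVlt => /predU1P[<- //|/IHm]; rewrite risingS => ->; rewrite mul0r.
Qed.

(** The rising factorial of [b] has a zero factor from index [N] on, so the
partial sums of the Gauss series are constant there. *)
Lemma hyp2F1_terminating a b c x N : rising b N = 0 ->
  hyp2F1 a b c x =
  \sum_(m < N) rising a m * rising b m / (rising c m * m`!%:R) * x ^+ m.
Proof.
move=> bN0; rewrite /hyp2F1; apply: lim_near_cst => //.
near=> n; have Nn : (N <= n)%N by near: n; exact: nbhs_infty_ge.
rewrite /series /= (big_cat_nat _ (n := N)) //= big_mkord [X in _ + X]big1_seq ?addr0 //.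
move=> m /andP[_]; rewrite mem_index_iota => /andP[Nm _].
by rewrite (rising_eq0_le _ _ _ bN0 Nm) mulr0 !mul0r.
Unshelve. all: by end_near.
Qed.

Lemma risingN_nat N m : rising (- N%:R : R) m = (-1) ^+ m * (N ^_ m)%:R.
Proof.
elim: m => [|m IHm]; first by rewrite /rising big_ord0 expr0 ffactn0 mulr1.
rewrite risingS IHm ffactnSr; have [mN|Nm] := leqP m N.
  by rewrite natrM natrB // exprS; ring.
by rewrite ffact_small // !(mul0n, mulr0, mul0r).
Qed.

Lemma rising_nat j m : rising (j.+1%:R : R) m * j`!%:R = (j + m)`!%:R.
Proof.
elim: m => [|m IHm]; first by rewrite /rising big_ord0 mul1r addn0.
by rewrite risingS mulrAC IHm addnS factS mulnC natrM -natrD addSn.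
Qed.

Lemma rising_nat_neq0 j m : rising (j.+1%:R : R) m != 0.
Proof.
apply/eqP => j0; have := rising_nat j m.
by rewrite j0 mul0r => /esym/eqP; rewrite pnatr_eq0 eqn0Ngt fact_gt0.
Qed.

Lemma fact_neq0 m : m`!%:R != 0 :> R.
Proof. by rewrite pnatr_eq0 -lt0n fact_gt0. Qed.

Lemma hyp2F1_natE N r j q : hyp2F1 (- N%:R) (- r%:R) j.+1%:R q =
  \sum_(m < r.+1) (N ^_ m * 'C(r, m))%:R * j`!%:R / (j + m)`!%:R * q ^+ m.
Proof.
rewrite (@hyp2F1_terminating _ _ _ _ r.+1); last first.
  by rewrite risingN_nat ffact_small // mulr0.
apply: eq_bigr => m _; congr (_ * _); rewrite !risingN_nat -(bin_ffact r) !natrM.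
rewrite mulrACA -expr2 sqrr_sign mul1r -(rising_nat j m).
by field; rewrite rising_nat_neq0 !fact_neq0.
Qed.

(** With N = L + j, the factor L ^_ i (j - 1)! / (j - 1 + i)! of the i-th term of
the series becomes, once multiplied by 'C(N - 1, j - 1), the single binomial
coefficient 'C(N - 1, L - i).  When N < j the series no longer terminates
through its first parameter, but the leading binomial coefficient is 0. *)
Lemma bin_mul_hyp2F1 N r j q : (0 < j)%N -> (0 < N)%N ->
  'C(N - 1, j - 1)%:R * hyp2F1 (j%:R - N%:R) (- r%:R) j%:R q =
  \sum_(i < r.+1) if (j + i <= N)%N then
    q ^+ i *+ ('C(r, i) * 'C(N - 1, N - (j + i))) else 0.
Proof.
case: j => // j _ N0; rewrite !subn1 /=; have [jN|Nj] := leqP j.+1 N; last first.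
  rewrite bin_small ?mul0r; last by lia.
  by rewrite big1 // => i _; rewrite ifF //; lia.
rewrite -(subnK jN); move: (N - j.+1)%N => L {N N0 jN}.
rewrite natrD opprD addrCA subrr addr0 hyp2F1_natE mulr_sumr; apply: eq_bigr => i _.
rewrite (addnC j.+1 i) leq_add2r.
have [iL|Li] := leqP i L; last first.
  by rewrite ffact_small // mul0n mulr0n !(mul0r, mulr0).
rewrite addnS /=.
rewrite (_ : (L + j).+1 - (i + j.+1) = L - i)%N; last by lia.
rewrite -(mulr_natr (q ^+ i)) !natrM.
have E1 : 'C(L + j, j)%:R * (j`!%:R * L`!%:R) = (L + j)`!%:R :> R.
  by rewrite -!natrM -(bin_fact (leq_addl L j)) addnK.
have E2 : 'C(L + j, L - i)%:R * ((L - i)`!%:R * (j + i)`!%:R) = (L + j)`!%:R :> R.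
  rewrite -!natrM -(@bin_fact (L + j) (L - i)); last by lia.
  by rewrite (_ : L + j - (L - i) = j + i)%N //; lia.
have E3 : (L ^_ i)%:R * (L - i)`!%:R = L`!%:R :> R by rewrite -natrM ffact_fact.
have n1 := fact_neq0 (L - i); have n2 := fact_neq0 (j + i).
have n3 := fact_neq0 j; have n4 := fact_neq0 L.
apply: (mulfI n1); apply: (mulIf n2).
transitivity ('C(r, i)%:R * q ^+ i * ('C(L + j, j)%:R * (j`!%:R * L`!%:R))).
  by rewrite -E3; field.
by rewrite E1 -E2; ring.
Qed.

(** This is the inner sum of [run_timeE] for j = 0.  Its summand i = 0 vanishes because 'C(n - 1, n) = 0, and the
shift of i by one produces the parameters 1 - n, 1 - r, 2 and the factor
q r. *)
Lemma scaled_hyp2F1 n r q : (0 < n)%N -> (0 < r)%N ->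
  q * r%:R * hyp2F1 (1 - n%:R) (1 - r%:R) 2 q =
  \sum_(i < r.+1) if (i <= n)%N then
    q ^+ i *+ ('C(r, i) * 'C(n - 1, n - i)) else 0.
Proof.
case: n r => // n [] // r _ _.
have predE m : 1 - m.+1%:R = - m%:R :> R by rewrite -natr1; ring.
rewrite !predE subn1 /= hyp2F1_natE.
rewrite [RHS]big_ord_recl [X in _ = X + _](_ : _ = 0) ?add0r; last first.
  by rewrite /= (@bin_small n) ?muln0 //; lia.
rewrite mulr_sumr.
apply: eq_bigr => i _; rewrite lift0 ltnS subSS add1n.
have [iN|Ni] := leqP i n; last first.
  by rewrite ffact_small // mul0n mulr0n !(mul0r, mulr0).
rewrite bin_sub // -(mulr_natr (q ^+ i.+1)) -bin_ffact (factS i) (_ : 1`! = 1)%N // !natrM exprS.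
have := congr1 (fun m => m%:R : R) (mul_bin_diag r.+1 i); rewrite !natrM /= => E.
have n1 := fact_neq0 i; have n2 : i.+1%:R != 0 :> R by rewrite pnatr_eq0.
apply: (mulIf n2); transitivity (q * q ^+ i * 'C(n, i)%:R * (r.+1%:R * 'C(r, i)%:R)).
  by field; rewrite n1 nat1r n2.
by rewrite E; ring.
Qed.

Lemma run_time_hypE k r n (p : R) : (0 < k)%N -> (0 < r)%N -> (0 < n)%N ->
  let q := 1 - p in
  run_time R k p r (r * k + n) =
  p ^+ (r * k) *
    (q * r%:R * hyp2F1 (1 - n%:R) (1 - r%:R) 2 q +
     \sum_(1 <= j < ((n - 1) %/ k).+1)
        (-1) ^+ j * p ^+ (j * k) * q ^+ j
        * 'C(r + j - 1, r - 1)%:R * 'C(n - j * k - 1, j - 1)%:R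
        * hyp2F1 ((j * k)%:R + j%:R - n%:R) (- r%:R) j%:R q).
Proof.
move=> k0 r0 n0 q; rewrite run_timeE // -/q.
(* [W j] collects the terms of index [j]; it vanishes when n <= j k. *)
pose inner (j : nat) : R := \sum_(i < r.+1) if (j * k + j + i <= n)%N then
    q ^+ i *+ ('C(r, i) * 'C(n - j * k - 1, n - (j * k + j + i))) else 0.
pose W (j : nat) : R := (-1) ^+ j * p ^+ (j * k) * q ^+ j * 'C(r + j - 1, j)%:R * inner j.
transitivity (p ^+ (r * k) * \sum_(j < (r * k + n).+1) W j).
  rewrite mulr_sumr; apply: eq_bigr => j _; rewrite /W /inner mulrA mulr_sumr.
  apply: eq_bigr => i _; case: leqP => _; last by rewrite mulr0.
  by rewrite -[LHS]mulr_natr -[q ^+ i *+ _]mulr_natr !natrM !exprD; ring.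
congr (_ * _); rewrite -(big_mkord xpredT W) big_ltn //; congr (_ + _).
  rewrite scaled_hyp2F1 // /W /inner !(mul1r, mul0n) bin0 mul1r.
  by apply: eq_bigr => i _; rewrite !add0n subn0.
have divn_lt : ((n - 1) %/ k < r * k + n)%N.
  by rewrite (leq_ltn_trans (leq_div _ _)) //; lia.
have -> : \sum_(1 <= j < (r * k + n).+1) W j =
    \sum_(1 <= j < ((n - 1) %/ k).+1) W j.
  rewrite (big_cat_nat _ (n := ((n - 1) %/ k).+1)) //=; last exact: ltnW.
  rewrite [X in _ + X]big1_seq ?addr0 //.
  move=> j /andP[_]; rewrite mem_index_iota => /andP[Dj _].
  have j0 := leq_ltn_trans (leq0n _) Dj; move: Dj; rewrite ltn_divLR // => jkn.
  rewrite /W /inner big1 ?mulr0 // => i _.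
  by rewrite ifF //; lia.
apply: eq_big_nat => j /andP[j0]; rewrite ltnS leq_divRL // => jkn.
rewrite /W -[in 'C(r + j - 1, r - 1)](@bin_sub _ _ (_ : r - 1 <= r + j - 1)%N); last by lia.
rewrite (_ : r + j - 1 - (r - 1) = j)%N; last by lia.
have -> : (j * k)%:R + j%:R - n%:R = j%:R - (n - j * k)%:R :> R.
  by rewrite natrB; [ring | lia].
rewrite -[RHS]mulrA bin_mul_hyp2F1 //; last by lia.
congr (_ * _); apply: eq_bigr => i _; rewrite subnDA -addnA.
by rewrite leq_subRL ?subnDA //; lia.
Qed.

End Hypergeometric.

(** * From trials to the run chain *)

Section WaitingTime.
Variables (R : realType) (k r : nat) (x : nat -> bool).

Lemma run_countS n :
  run_count k x n.+1 = run_count k x n \/ run_count k x n.+1 = (run_count k x n).+1.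
Proof.
rewrite /run_count /= /run_step; case: (x n); last by left.
by case: ifP => _; [right | left].
Qed.

Lemma run_count_homo : {homo run_count k x : m n / (m <= n)%N}.
Proof.
apply: homo_leq => [//|? ? ?|n]; first exact: leq_trans.
by case: (run_countS n) => ->.
Qed.

(** The outcome [x n] is that of trial number [n.+1].  As the count never decreases and grows by at
most one per trial, it first equals [r] when it passes from [r - 1] to [r]. *)
Lemma waiting_timeP n : (0 < r)%N ->
  waiting_time R k r x = (n.+1%:R)%:E <->
  [/\ x n, (run_state k x n).1.+1 = r & (run_state k x n).2.+1 = k].
Proof.
move=> r0; pose S := [set (m%:R : R)%:E | m in [set m | run_count k x m = r]].
have firstE : [/\ x n, (run_state k x n).1.+1 = r & (run_state k x n).2.+1 = k] <->
    run_count k x n.+1 = r /\ run_count k x n <> r.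
  rewrite /run_count /= /run_step.
  case: (run_state k x n) => c e /=; case: (x n) => /=; last by split=> -[].
  case: eqP => ek /=; split.
  - by move=> [_ cr _]; split=> // /eqP; rewrite -cr ltn_eqF.
  - by move=> [cr _].
  - by move=> [_ _ /ek].
  - by move=> [cr /(_ cr)].
rewrite firstE; split=> [YE|[nr nr']]; last first.
  apply/eqP; rewrite eq_le; apply/andP; split.
    by apply: ereal_inf_lbound; exists n.+1.
  apply: le_ereal_inf_tmp => _ [m mr <-]; rewrite lee_fin ler_nat ltnNge.
  apply/negP => /run_count_homo; rewrite mr.
  have /run_count_homo := leqnSn n; rewrite nr => le1 le2.
  by apply: nr'; apply/eqP; rewrite eqn_leq le1 le2.
have attained m : run_count k x m = r -> (n.+1 <= m)%N.
  move=> mr; rewrite -(ler_nat R) -lee_fin -YE; apply: ereal_inf_lbound.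
  by exists m.
split; last by move/attained; rewrite ltnn.
have : exists2 y, S y & (y < n.+1%:R%:E + 1%:E)%E.
  rewrite -YE; apply: lb_ereal_inf_adherent => //.
  by rewrite -/(waiting_time R k r x) YE.
move=> [_ [m mr <-]]; rewrite lte_fin natr1 ltr_nat ltnS => mn.
by have := attained _ mr => nm; rewrite (_ : n.+1 = m) //; apply/eqP; rewrite eqn_leq nm mn.
Qed.

End WaitingTime.

Section RunLaw.
Context (R : realType) (d : measure_display) (T : measurableType d)
  (P : probability T R) (k : nat) (p : R) (X : nat -> {RV P >-> bool}).
Hypotheses (p_gt0 : 0 < p) (p_lt1 : p < 1)
  (X_bernoulli : forall i, distribution P (X i) =1 bernoulli_prob p)
  (X_indep : mutually_independent X).

Let state m w := run_state k (fun i => X i w) m.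
Let cyl (s : seq nat) (B : nat -> set bool) := \bigcap_(i in [set` s]) (X i @^-1` B i).

Lemma trial_prob i b : P (X i @^-1` [set b]) = (if b then p else 1 - p)%:E.
Proof.
have := X_bernoulli i [set b]; rewrite /distribution /pushforward /= => ->.
rewrite bernoulli_probE ?(ltW p_gt0) ?(ltW p_lt1) //.
rewrite !diracE /=; case: b.
  by rewrite mem_set // memNset // mule1 mule0 adde0.
by rewrite memNset // mem_set // mule1 mule0 add0e.
Qed.

Lemma measurable_trial i B : measurable (X i @^-1` B).
Proof. by rewrite -[X in measurable X]setTI; apply: (measurable_funPT (X i)). Qed.

Lemma measurable_cyl s B : measurable (cyl s B).
Proof.
by apply: fin_bigcap_measurable => // i _; exact: measurable_trial.
Qed.

Lemma measurable_state m (Q : pred (nat * nat)) : measurable [set w | Q (state m w)].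
Proof.
elim: m Q => [|m IHm] Q.
  rewrite /state /=; case: (Q (0, 0)%N); first by rewrite set_true; exact: measurableT.
  by rewrite set_false; exact: measurable0.
rewrite (_ : [set _ | _] =
  (X m @^-1` [set true] `&` [set w | Q (run_step k (state m w) true)]) `|`
  (X m @^-1` [set false] `&` [set w | Q (run_step k (state m w) false)])).
  apply: measurableU; apply: measurableI; try exact: measurable_trial.
    exact: (IHm (fun s => Q (run_step k s true))).
  exact: (IHm (fun s => Q (run_step k s false))).
rewrite /state; apply/seteqP; split=> w /=.
  by case: (X m w) => ?; [left | right].
by case=> -[->].
Qed.

(** The state after [m] trials is independent of the trials from [m] on.  The
cylinder on later trials is what makes the induction work: trial [m] moves
from the state to the cylinder, where independence of the family applies. *)
Lemma state_cyl_prob m (Q : pred (nat * nat)) s (B : nat -> set bool) :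
  uniq s -> {in s, forall i, (m <= i)%N} ->
  P ([set w | Q (state m w)] `&` cyl s B) =
  ((run_prob R k p m Q)%:E * P (cyl s B))%E.
Proof.
elim: m Q s B => [|m IHm] Q s B s_uniq s_ge.
  rewrite /state /run_prob /=; case: (Q (0, 0)%N).
    by rewrite set_true setTI mul1e.
  by rewrite set_false set0I measure0 mul0e.
have m_notin : m \notin s by apply/negP => /s_ge; rewrite ltnn.
pose Bm b i := if i == m then [set b] else B i.
have cylE b : cyl (m :: s) (Bm b) = X m @^-1` [set b] `&` cyl s B.
  apply/seteqP; split=> w /=.
    move=> H; split; first by have := H m (mem_head _ _); rewrite /Bm eqxx.
    move=> i /= si; have := H i; rewrite /= inE si orbT => /(_ isT).
    by rewrite /Bm ifN //; apply: contraNneq m_notin => <-.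
  move=> [Hm H] i /=; rewrite inE /Bm => /predU1P[->|si]; first by rewrite eqxx.
  by rewrite ifN; [exact: H | apply: contraNneq m_notin => <-].
have cyl_prob b : P (cyl (m :: s) (Bm b)) = ((if b then p else 1 - p)%:E * P (cyl s B))%E.
  rewrite /cyl !X_indep //=; last by rewrite m_notin.
  rewrite big_cons /Bm eqxx trial_prob; congr (_ * _)%E.
  apply: eq_big_seq => i si; rewrite ifN //; by apply: contraNneq m_notin => <-.
have step b : P ([set w | Q (run_step k (state m w) b)] `&` cyl (m :: s) (Bm b)) =
    ((run_prob R k p m (fun t => Q (run_step k t b)))%:E *
     ((if b then p else 1 - p)%:E * P (cyl s B)))%E.
  rewrite (IHm (fun t => Q (run_step k t b))) ?cyl_prob //=; first by rewrite m_notin.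
  by move=> i; rewrite inE => /predU1P[->//|/s_ge/ltnW].
have mstep b : measurable ([set w | Q (run_step k (state m w) b)] `&` cyl (m :: s) (Bm b)).
  apply: measurableI; last exact: measurable_cyl.
  exact: (measurable_state m (fun t => Q (run_step k t b))).
rewrite (_ : _ `&` _ =
  ([set w | Q (run_step k (state m w) false)] `&` cyl (m :: s) (Bm false)) `|`
  ([set w | Q (run_step k (state m w) true)] `&` cyl (m :: s) (Bm true))); last first.
  rewrite !cylE /state; apply/seteqP; split=> w /=.
    by move=> [+ Hs]; case E: (X m w) => HQ; [right|left].
  by case=> -[HQ [-> Hs]].
rewrite measureU //; last first.
  rewrite !cylE; apply/seteqP; split=> // w /= [[_ [-> _]] [_ []]] //.
apply: (etrans (f_equal2 (fun a b => a + b)%E (step false) (step true))).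
have -> : P (cyl s B) = (fine (P (cyl s B)))%:E.
  by rewrite fineK // fin_num_measure //; exact: measurable_cyl.
by rewrite -!EFinM -EFinD /run_prob /=; congr EFin; ring.
Qed.

(** The cylinder of [state_cyl_prob] is taken to be the success that completes
the last run. *)
Lemma waiting_time_law r n : (0 < r)%N -> (0 < n)%N ->
  P [set w | waiting_time R k r (fun i => X i w) = n%:R%:E] = (run_time R k p r n)%:E.
Proof.
case: n => // n r0 _.
pose Q (s : nat * nat) := (s.1.+1 == r) && (s.2.+1 == k).
rewrite (_ : [set _ | _] =
    [set w | Q (state n w)] `&` cyl [:: n] (fun=> [set true])); last first.
  apply/seteqP; split=> w /=.
    move/waiting_timeP => /(_ r0)[xn /eqP c /eqP e]; split; first by rewrite /Q c e.
    by move=> i /=; rewrite inE => /eqP ->.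
  move=> [/andP[/eqP c /eqP e] H]; apply/waiting_timeP => //; split=> //.
  by have := H n (mem_head _ _).
rewrite state_cyl_prob //; last by move=> i; rewrite inE => /eqP ->.
rewrite /cyl X_indep // big_seq1 trial_prob -EFinM mulrC /=.
by [].
Qed.

End RunLaw.

(** * The law of the waiting time *)

Theorem mainTheorem2 (R : realType) (d : measure_display) (T : measurableType d)
    (P : probability T R) (k r : nat) (p : R) (X : nat -> {RV P >-> bool})
    (k_ge1 : (1 <= k)%N) (r_ge1 : (1 <= r)%N) (p_gt0 : 0 < p) (p_lt1 : p < 1)
    (X_bernoulli : forall i, distribution P (X i) =1 bernoulli_prob p)
    (X_indep : mutually_independent X) :
  let q := 1 - p in
  let Y (w : T) : \bar R := waiting_time R k r (fun i => X i w) in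
  (forall n : nat, (1 <= n)%N ->
     P [set w | (Y w - (r * k)%:R%:E = n%:R%:E)%E] =
     (p ^+ (r * k) *
        (q * r%:R * hyp2F1 (1 - n%:R) (1 - r%:R) 2 q +
         \sum_(1 <= j < ((n - 1) %/ k).+1)
            (-1) ^+ j * p ^+ (j * k) * q ^+ j
            * 'C(r + j - 1, r - 1)%:R * 'C(n - j * k - 1, j - 1)%:R
            * hyp2F1 ((j * k)%:R + j%:R - n%:R) (- r%:R) j%:R q))%:E) /\
  (forall n : nat, (r * k + 1 <= n)%N ->
     P [set w | Y w = n%:R%:E] =
     (p ^+ (r * k) *
        (q * r%:R * hyp2F1 ((r * k)%:R + 1 - n%:R) (1 - r%:R) 2 q +
         \sum_(1 <= j < ((n - r * k - 1) %/ k).+1)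
            (-1) ^+ j * p ^+ (j * k) * q ^+ j
            * 'C(n - (r + j) * k - 1, j - 1)%:R * 'C(r + j - 1, r - 1)%:R
            * hyp2F1 (((r + j) * k)%:R + j%:R - n%:R) (- r%:R) j%:R q))%:E).
Proof.
move=> q Y; have law n : (0 < n)%N ->
    P [set w | Y w = (r * k + n)%:R%:E] = (run_time R k p r (r * k + n))%:E.
  move=> n0; apply: waiting_time_law => //.
  by rewrite addn_gt0 n0 orbT.
split=> n.
  move=> n0; rewrite -run_time_hypE // -law //; congr (P _).
  apply/seteqP; split=> w /= => [|->]; last by rewrite -EFinB natrD addrC addKr.
  case: (Y w) => // y; rewrite -EFinB => -[yE].
  by rewrite natrD -yE addrC subrK.
rewrite addn1 => nrk; rewrite -(subnKC (ltnW nrk)).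
have : (0 < n - r * k)%N by rewrite subn_gt0.
move: (n - r * k)%N => N N0 {n nrk}; rewrite law // run_time_hypE // addKn.
have paramE (j : nat) : ((r + j) * k)%:R + j%:R - (r * k + N)%:R =
    (j * k)%:R + j%:R - N%:R :> R by rewrite mulnDl !natrD; ring.
have -> : (r * k)%:R + 1 - (r * k + N)%:R = 1 - N%:R :> R by rewrite natrD; ring.
have subE (j : nat) : (r * k + N - (r + j) * k = N - j * k)%N.
  by rewrite mulnDl subnDl.
by under [in RHS]eq_bigr => j _ do rewrite paramE subE [X in X * _]mulrAC.
Qed.
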